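(* Let $n\ge2$, $A=(a_{ij})\in M_n(\mathbb{H})$ and $\gamma\in[0,1]$. Then all the left eigenvalues of $A$ are located in the union of the $\frac{n(n-1)}{2}$ ovals of Cassini $$K_{ij}(A):=\{z\in\mathbb{H}: |z-a_{ii}|\,|z-a_{jj}|\le r_i(A)^{\gamma}\,r_j(A)^{\gamma}\,c_i(A)^{1-\gamma}\,c_j(A)^{1-\gamma}\},\qquad 1\le i,j\le n,\ i\ne j;$$ that is, $\Lambda_l(A)\subseteq K(A):=\bigcup_{i,j=1,\,i\neq j}^n K_{ij}(A)$.
   Context: $\mathbb{H}$ is the skew field of real quaternions with its usual modulus $|\cdot|$, and $M_n(\mathbb{H})$ is the set of $n\times n$ quaternionic matrices. A quaternion $\lambda$ is a left eigenvalue of $A$ if $Ax=\lambda x$ for some nonzero column vector $x\in\mathbb{H}^n$; $\Lambda_l(A)$ is the set of left eigenvalues. $r_i(A):=\sum_{j\ne i}|a_{ij}|$ and $c_i(A):=\sum_{j\neq i}|a_{ji}|$. Convention: $0^0=1$. *)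

(* Defs.v *)
From HB Require Import structures.
From mathcomp Require Import all_boot all_order all_algebra.
From mathcomp Require Import ring.
From mathcomp Require Import all_classical all_reals all_analysis.

Set Implicit Arguments.
Unset Strict Implicit.
Unset Printing Implicit Defensive.

Import Order.TTheory GRing.Theory Num.Theory.
Local Open Scope ring_scope.
Local Open Scope classical_set_scope.

(* [Quat a b c d] is a + b i + c j + d k *)
Record quat (R : Type) := Quat { qre : R; qi : R; qj : R; qk : R }.

Definition quat_tuple (R : Type) (x : quat R) : R * R * R * R :=
  (qre x, qi x, qj x, qk x).

Definition tuple_quat (R : Type) (t : R * R * R * R) : quat R :=
  let: (a, b, c, d) := t in Quat a b c d.

Lemma quat_tupleK (R : Type) : cancel (@quat_tuple R) (@tuple_quat R).
Proof. by case. Qed.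

HB.instance Definition _ (R : realType) :=
  Choice.copy (quat R) (can_type (@quat_tupleK R)).

Section QuatRing.
Variable R : realType.
Implicit Types x y z : quat R.

Definition quat0 : quat R := Quat 0 0 0 0.

Definition quat1 : quat R := Quat 1 0 0 0.

Definition oppquat x : quat R := Quat (- qre x) (- qi x) (- qj x) (- qk x).

Definition addquat x y : quat R :=
  Quat (qre x + qre y) (qi x + qi y) (qj x + qj y) (qk x + qk y).

(* Hamilton's product: i^2 = j^2 = k^2 = ijk = -1 *)
Definition mulquat x y : quat R :=
  Quat (qre x * qre y - qi x * qi y - qj x * qj y - qk x * qk y)
       (qre x * qi y + qi x * qre y + qj x * qk y - qk x * qj y)
       (qre x * qj y - qi x * qk y + qj x * qre y + qk x * qi y)
       (qre x * qk y + qi x * qj y - qj x * qi y + qk x * qre y).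

Definition quat_sqrmod x : R := qre x ^+ 2 + qi x ^+ 2 + qj x ^+ 2 + qk x ^+ 2.

Definition invquat x : quat R :=
  Quat (qre x / quat_sqrmod x) (- qi x / quat_sqrmod x)
       (- qj x / quat_sqrmod x) (- qk x / quat_sqrmod x).

Lemma addquatA : associative addquat.
Proof. by move=> [????] [????] [????]; congr Quat; rewrite /= addrA. Qed.

Lemma addquatC : commutative addquat.
Proof. by move=> [????] [????]; congr Quat; rewrite /= addrC. Qed.

Lemma add0quat : left_id quat0 addquat.
Proof. by move=> [????]; congr Quat; rewrite /= add0r. Qed.

Lemma addNquat : left_inverse quat0 oppquat addquat.
Proof. by move=> [????]; congr Quat; rewrite /= addNr. Qed.

HB.instance Definition _ :=
  GRing.isZmodule.Build (quat R) addquatA addquatC add0quat addNquat.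

Lemma mulquatA : associative mulquat.
Proof. by move=> [????] [????] [????]; congr Quat => /=; ring. Qed.

Lemma mul1quat : left_id quat1 mulquat.
Proof. by move=> [????]; congr Quat => /=; ring. Qed.

Lemma mulquat1 : right_id quat1 mulquat.
Proof. by move=> [????]; congr Quat => /=; ring. Qed.

Lemma mulquatDl : left_distributive mulquat addquat.
Proof. by move=> [????] [????] [????]; congr Quat => /=; ring. Qed.

Lemma mulquatDr : right_distributive mulquat addquat.
Proof. by move=> [????] [????] [????]; congr Quat => /=; ring. Qed.

Lemma quat1_neq0 : quat1 != 0.
Proof. by apply/eqP => -[] /eqP; rewrite oner_eq0. Qed.

HB.instance Definition _ := GRing.Zmodule_isNzRing.Build (quat R)
  mulquatA mul1quat mulquat1 mulquatDl mulquatDr quat1_neq0.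

Lemma quat_sqrmod_eq0 x : (quat_sqrmod x == 0) = (x == 0).
Proof.
apply/idP/eqP => [|->]; last by rewrite /quat_sqrmod /= expr0n /= !addr0.
case: x => a b c d; rewrite /quat_sqrmod /= !paddr_eq0 ?addr_ge0 ?sqr_ge0 //.
by rewrite !sqrf_eq0 => /andP[/andP[/andP[/eqP-> /eqP->] /eqP->] /eqP->].
Qed.

Lemma mulVquat x : x != 0 -> mulquat (invquat x) x = quat1.
Proof.
rewrite -quat_sqrmod_eq0; case: x => a b c d; rewrite /quat_sqrmod /= => x0.
by congr Quat => /=; rewrite /quat_sqrmod /=; field.
Qed.

Lemma mulquatV x : x != 0 -> mulquat x (invquat x) = quat1.
Proof.
rewrite -quat_sqrmod_eq0; case: x => a b c d; rewrite /quat_sqrmod /= => x0.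
by congr Quat => /=; rewrite /quat_sqrmod /=; field.
Qed.

Lemma unitquatP x y : y * x = 1 /\ x * y = 1 -> x != 0.
Proof.
by case=> _ xy1; apply/eqP => x0; move/eqP: xy1; rewrite x0 mul0r eq_sym oner_eq0.
Qed.

Lemma invquat_out x : ~~ (x != 0) -> invquat x = x.
Proof. by rewrite negbK => /eqP->; congr Quat; rewrite /= ?oppr0 mul0r. Qed.

HB.instance Definition _ := GRing.NzRing_hasMulInverse.Build (quat R)
  mulVquat mulquatV unitquatP invquat_out.

Definition quat_mod x : R := Num.sqrt (quat_sqrmod x).

End QuatRing.

Section LeftSpectrum.
Variables (R : realType) (n : nat).
Implicit Types (A : 'M[quat R]_n) (i j : 'I_n).

(* [*:] on matrices multiplies every entry by the scalar on the left *)
Definition left_eigenvalues A : set (quat R) :=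
  [set l | exists2 x : 'cV[quat R]_n, x != 0 & A *m x = l *: x].

Definition row_radius A i : R := \sum_(j < n | j != i) quat_mod (A i j).

Definition col_radius A i : R := \sum_(j < n | j != i) quat_mod (A j i).

(* 0 `^ 0 = 1, and 0 `^ s = 0 for s != 0 *)
Definition cassini_oval A (gamma : R) i j : set (quat R) :=
  [set z | quat_mod (z - A i i) * quat_mod (z - A j j) <=
    row_radius A i `^ gamma * row_radius A j `^ gamma *
    col_radius A i `^ (1 - gamma) * col_radius A j `^ (1 - gamma)].

(* so the ovals with i != j are indexed by the n(n-1)/2 unordered pairs *)
Lemma cassini_ovalC A gamma i j : cassini_oval A gamma i j = cassini_oval A gamma j i.
Proof.
apply/seteqP; split=> z; rewrite /cassini_oval /= => h.
  by rewrite mulrC (mulrC (row_radius A j `^ gamma)) mulrAC.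
by rewrite mulrC (mulrC (row_radius A i `^ gamma)) mulrAC.
Qed.

End LeftSpectrum.

(* Main.v *)
Require Import Defs.
From HB Require Import structures.
From mathcomp Require Import all_boot all_order all_algebra.
From mathcomp Require Import ring lra.
From mathcomp Require Import all_classical all_reals all_analysis.

Set Implicit Arguments.
Unset Strict Implicit.

Import Order.TTheory GRing.Theory Num.Theory.
Local Open Scope ring_scope.
Local Open Scope classical_set_scope.

(** Let [A x = l x] with [x <> 0]. Row [i] reads
    [(l - a_ii) x_i = \sum_(j != i) a_ij x_j], and the quaternionic modulus is
    multiplicative and subadditive, so the real numbers [d i = |l - a_ii|],
    [b i j = |a_ij|] and [y i = |x_i|] satisfy
    [d i * y i <= \sum_(j != i) b i j * y j]. It remains to find
    [i != j] with [d i * d j <= s i * s j], where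
    [s i = r_i ^ g * c_i ^ (1 - g)] is built from the off-diagonal row and column
    sums of [b].

    For [g = 1] this is Brauer's argument with the two largest entries of [y]
    ([brauer_oval]). For [g < 1], one first proves Ostrowski's disk theorem: some
    [i] has [d i <= s i] ([ostrowski_disk]). Hoelder's inequality bounds each row
    in terms of [r_i] and of [\sum_(j != i) b i j * y j ^ (1 / (1 - g))], and
    summing these last quantities over [i] brings out the column sums.

    The passage from disks to ovals ([ostrowski_oval]) is by scaling. If every
    product [d i * d j] exceeded [s i * s j], only one index could satisfy
    [d i <= s i]; multiplying that one inequality of the system by a suitable
    constant pushes its index outside its disk while the others stay
    outside theirs, which contradicts the disk theorem for the scaled system. *)

(** * The quaternionic modulus is multiplicative and subadditive *)

Lemma quat_sqrmod_ge0 (R : realType) (x : quat R) : 0 <= quat_sqrmod x.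
Proof. by rewrite /quat_sqrmod !addr_ge0 // sqr_ge0. Qed.

Lemma quat_mod_ge0 (R : realType) (x : quat R) : 0 <= quat_mod x.
Proof. exact: sqrtr_ge0. Qed.

Lemma quat_mod0 (R : realType) : quat_mod (0 : quat R) = 0.
Proof. by rewrite /quat_mod /quat_sqrmod /= expr0n /= !addr0 sqrtr0. Qed.

Lemma quat_mod_gt0 (R : realType) (x : quat R) : (0 < quat_mod x) = (x != 0).
Proof.
by rewrite /quat_mod sqrtr_gt0 lt_neqAle quat_sqrmod_ge0 andbT eq_sym
  quat_sqrmod_eq0.
Qed.

(** Euler's four-square identity. *)
Lemma quat_modM (R : realType) (x y : quat R) :
  quat_mod (x * y) = quat_mod x * quat_mod y.
Proof.
rewrite /quat_mod -sqrtrM ?quat_sqrmod_ge0 //; congr Num.sqrt.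
by case: x y => [a b c d] [e f g h]; rewrite /quat_sqrmod /=; ring.
Qed.

(** Cauchy-Schwarz in dimension four: the defect [|x|^2 |y|^2 - <x, y>^2] is, by
    the four-square identity applied to the product of [x] conjugated and [y],
    the sum of the squares of the three imaginary parts of that product. *)
Lemma quat_modD (R : realType) (x y : quat R) :
  quat_mod (x + y) <= quat_mod x + quat_mod y.
Proof.
pose dot := qre x * qre y + qi x * qi y + qj x * qj y + qk x * qk y.
have le_dot : dot <= quat_mod x * quat_mod y.
  rewrite /quat_mod -sqrtrM ?quat_sqrmod_ge0 //.
  apply: le_trans (ler_norm _) _; rewrite -sqrtr_sqr; apply: ler_wsqrtr.
  rewrite /dot; case: x y {dot} => [a b c d] [e f g h] /=.
  rewrite /quat_sqrmod /= -subr_ge0.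
  have -> : (a ^+ 2 + b ^+ 2 + c ^+ 2 + d ^+ 2) *
      (e ^+ 2 + f ^+ 2 + g ^+ 2 + h ^+ 2) -
      (a * e + b * f + c * g + d * h) ^+ 2 =
      (a * f - b * e - c * h + d * g) ^+ 2 +
      (a * g + b * h - c * e - d * f) ^+ 2 +
      (a * h - b * g + c * f - d * e) ^+ 2 by ring.
  by rewrite !addr_ge0 // sqr_ge0.
rewrite -(ler_pXn2r (ltn0Sn 1)) ?nnegrE ?addr_ge0 ?quat_mod_ge0 //.
rewrite sqrrD !sqr_sqrtr ?quat_sqrmod_ge0 //.
have -> : quat_sqrmod (x + y) = quat_sqrmod x + dot *+ 2 + quat_sqrmod y.
  by rewrite /dot; case: x y {dot le_dot} => [a b c d] [e f g h];
     rewrite /quat_sqrmod /=; ring.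
by rewrite lerD2r lerD2l lerMn2r.
Qed.

Lemma quat_mod_sum (R : realType) (I : finType) (P : pred I) (F : I -> quat R) :
  quat_mod (\sum_(i | P i) F i) <= \sum_(i | P i) quat_mod (F i).
Proof.
elim/big_ind2: _ => [|a u b v ha hb|//]; first by rewrite quat_mod0.
exact: le_trans (quat_modD _ _) (lerD ha hb).
Qed.

(** * Hoelder's inequality for finite sums *)

(** The product [u ^ g * v ^ (1 - g)] is superadditive in [(u, v)]. With
    [0 ^ 0 = 1] the end points [g = 0] and [g = 1] are equalities; inside,
    this is the two-term Hoelder inequality for the exponents [1 / g] and
    [1 / (1 - g)]. *)
Lemma geometric_mean_superadditive (R : realType) (g a b c d : R) :
  0 <= g <= 1 -> 0 <= a -> 0 <= b -> 0 <= c -> 0 <= d ->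
  a `^ g * b `^ (1 - g) + c `^ g * d `^ (1 - g) <=
  (a + c) `^ g * (b + d) `^ (1 - g).
Proof.
move=> /andP[g0 g1] a0 b0 c0 d0.
move: g0; rewrite le_eqVlt => /predU1P[<-|g0].
  by rewrite subr0 !powRr0 !mul1r !powRr1 ?addr_ge0.
move: g1; rewrite le_eqVlt => /predU1P[->|g1].
  by rewrite subrr !powRr0 !mulr1 !powRr1 ?addr_ge0.
have h0 : 0 < 1 - g by rewrite subr_gt0.
have := @hoelder2 R (a `^ g) (c `^ g) (b `^ (1 - g)) (d `^ (1 - g)) g^-1 (1 - g)^-1.
rewrite !invrK -!powRrM !mulfV ?gt_eqF // !powRr1 //; apply;
  rewrite ?powR_ge0 ?invr_gt0 //; ring.
Qed.

Lemma hoelder_sum (R : realType) (I : finType) (P : pred I) (g : R)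
    (u v : I -> R) : 0 <= g <= 1 ->
  (forall i, 0 <= u i) -> (forall i, 0 <= v i) ->
  \sum_(i | P i) u i `^ g * v i `^ (1 - g) <=
  (\sum_(i | P i) u i) `^ g * (\sum_(i | P i) v i) `^ (1 - g).
Proof.
move=> g01 u0 v0.
suff: [/\ 0 <= \sum_(i | P i) u i, 0 <= \sum_(i | P i) v i &
  \sum_(i | P i) u i `^ g * v i `^ (1 - g) <=
  (\sum_(i | P i) u i) `^ g * (\sum_(i | P i) v i) `^ (1 - g)] by case.
rewrite -[\sum_(i | P i) u i]big_filter -[\sum_(i | P i) v i]big_filter.
rewrite -[\sum_(i | P i) _ * _]big_filter.
elim: (seq.filter _ _) => [|i s [U0 V0 IH]].
  by rewrite !big_nil; split; rewrite // mulr_ge0 ?powR_ge0.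
rewrite !big_cons; split; rewrite ?addr_ge0 //.
apply: le_trans (geometric_mean_superadditive g01 (u0 i) (v0 i) U0 V0).
by rewrite lerD2l.
Qed.

(** * Inclusion theorems for dominated nonnegative systems *)

Lemma exists_neq (I : finType) : (1 < #|I|)%N -> forall i : I, exists j, j != i.
Proof.
move=> card2 i; apply: contrapT => none; move: card2.
rewrite ltnNge => /negP; apply.
rewrite -(card1 i); apply/subset_leq_card/fintype.subsetP => j _.
by rewrite inE; apply: contrapT => /negP ?; apply: none; exists j.
Qed.

Section DominatedSystem.
Variables (R : realType) (I : finType).
Implicit Types (b : I -> I -> R) (d y : I -> R) (g : R).

Definition off_row b i : R := \sum_(j | j != i) b i j.

Definition off_col b i : R := \sum_(j | j != i) b j i.

(** The radius of the [i]-th disk in Ostrowski's eigenvalue inclusion theorem. *)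
Definition ostrowski_radius g b i : R := off_row b i `^ g * off_col b i `^ (1 - g).

(** What remains of [B x = 0] once moduli are taken: [d] stands for the moduli
    of the diagonal entries, [b] off the diagonal for those of the other entries,
    and [y] for the moduli of the coordinates of [x]. *)
Definition dominated b d y : Prop :=
  forall i, d i * y i <= \sum_(j | j != i) b i j * y j.

Lemma ostrowski_radius_ge0 g b i : 0 <= ostrowski_radius g b i.
Proof. by rewrite mulr_ge0 ?powR_ge0. Qed.

Lemma off_row_ge0 b i : (forall i j, 0 <= b i j) -> 0 <= off_row b i.
Proof. by move=> b0; apply: sumr_ge0. Qed.

Lemma off_col_ge0 b i : (forall i j, 0 <= b i j) -> 0 <= off_col b i.
Proof. by move=> b0; apply: sumr_ge0. Qed.

(** Put [p = 1 / (1 - g)] and [S i = \sum_(j != i) b i j * y j ^ p]. Hoelder's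
    inequality gives [d i * y i <= off_row b i ^ g * S i ^ (1 - g)], so if every
    [d i] exceeded the radius then [off_col b i * y i ^ p <= S i], strictly where
    [y i > 0]. But both sides have the same sum over [i]. *)
Lemma ostrowski_disk g b d y : 0 <= g < 1 -> (forall i j, 0 <= b i j) ->
  (forall i, 0 <= y i) -> (exists i, 0 < y i) -> dominated b d y ->
  exists i, d i <= ostrowski_radius g b i.
Proof.
move=> /andP[g0 g1] b0 y0 [k yk] dom; apply: contrapT => far.
have {}far i : ostrowski_radius g b i < d i.
  by rewrite ltNge; apply/negP => ?; apply: far; exists i.
have h0 : 0 < 1 - g by rewrite subr_gt0.
pose p := (1 - g)^-1.
have powp z : 0 <= z -> (z `^ p) `^ (1 - g) = z.
  by move=> z0; rewrite -powRrM mulVf ?gt_eqF // powRr1.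
pose S i := \sum_(j | j != i) b i j * y j `^ p.
have S0 i : 0 <= S i by apply: sumr_ge0 => j _; rewrite mulr_ge0 ?powR_ge0.
have hoelder_row i : d i * y i <= off_row b i `^ g * S i `^ (1 - g).
  apply: le_trans (dom i) _.
  apply: le_trans (hoelder_sum (fun j => j != i) _ _ _); first last.
  - by move=> j; rewrite mulr_ge0 ?powR_ge0.
  - by [].
  - by rewrite g0 ltW.
  apply: ler_sum => j _; rewrite powRM ?powR_ge0 // powp // mulrA.
  by rewrite -powRD ?subrKC ?powRr1 // oner_eq0.
have lt_S i : 0 < y i -> off_col b i * y i `^ p < S i.
  move=> yi.
  have di : 0 < d i := le_lt_trans (ostrowski_radius_ge0 g b i) (far i).
  have Spos : 0 < S i.
    rewrite lt_neqAle S0 andbT; apply/eqP => Si0.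
    have := hoelder_row i; rewrite -Si0 powR0 ?gt_eqF // mulr0 leNgt.
    by rewrite mulr_gt0.
  have : off_col b i `^ (1 - g) * y i < S i `^ (1 - g).
    rewrite -(ltr_pM2l di) mulrCA.
    apply: (@le_lt_trans _ _ (ostrowski_radius g b i * S i `^ (1 - g))).
      by rewrite /ostrowski_radius mulrAC [leRHS]mulrC ler_wpM2l ?powR_ge0.
    by rewrite ltr_pM2r ?powR_gt0.
  rewrite -{1}(powp (y i)) // -powRM ?powR_ge0 ?off_col_ge0 //.
  apply: contraTT; rewrite -!leNgt => leS.
  by apply: ge0_ler_powR => //; rewrite ?nnegrE ?mulr_ge0 ?powR_ge0
    ?off_col_ge0 // ltW.
have le_S i : off_col b i * y i `^ p <= S i.
  have := y0 i; rewrite le_eqVlt => /predU1P[<-|/lt_S/ltW //].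
  by rewrite powR0 ?mulr0 // invr_neq0 // gt_eqF.
have eqS : \sum_i S i = \sum_i off_col b i * y i `^ p.
  rewrite /S (exchange_big_dep xpredT) //=; apply: eq_bigr => j _.
  by rewrite mulr_suml; apply: eq_bigl => i; rewrite eq_sym.
have : \sum_i off_col b i * y i `^ p < \sum_i S i.
  rewrite (bigD1 k) //= [ltRHS](bigD1 k) //=.
  by apply: ltr_leD; [exact: lt_S | apply: ler_sum => i _; exact: le_S].
by rewrite eqS ltxx.
Qed.

(** Brauer's argument: multiply the inequalities for the indices of the two
    largest entries of [y]. When the second largest is zero, the inequality for
    the largest forces its [d p] to vanish. *)
Lemma brauer_oval b d y : (1 < #|I|)%N -> (forall i j, 0 <= b i j) ->
  (forall i, 0 <= d i) -> (forall i, 0 <= y i) -> (exists i, 0 < y i) ->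
  dominated b d y ->
  exists i j, i != j /\ d i * d j <= off_row b i * off_row b j.
Proof.
move=> card2 b0 d0 y0 [k yk] dom.
have [p _ maxp] := @Order.TotalTheory.arg_maxP _ _ _ k xpredT y isT.
have yp : 0 < y p by apply: lt_le_trans yk (maxp k isT).
have [q0 q0p] := exists_neq card2 p.
have [q qp maxq] := @Order.TotalTheory.arg_maxP _ _ _ q0 (predC1 p) y q0p.
exists p, q; rewrite eq_sym; split=> //.
have hp : d p * y p <= off_row b p * y q.
  apply: le_trans (dom p) _; rewrite mulr_suml; apply: ler_sum => j jp.
  by rewrite ler_wpM2l //; exact: maxq.
have hq : d q * y q <= off_row b q * y p.
  apply: le_trans (dom q) _; rewrite mulr_suml; apply: ler_sum => j jq.
  by rewrite ler_wpM2l //; exact: maxp.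
have := y0 q; rewrite le_eqVlt => /predU1P[yq|yq].
  have : d p = 0.
    apply/eqP; rewrite eq_le d0 andbT -(ler_pM2r yp) mul0r.
    by rewrite -yq mulr0 in hp.
  by move=> ->; rewrite mul0r mulr_ge0 ?off_row_ge0.
rewrite -(ler_pM2r (mulr_gt0 yp yq)) mulrACA.
have -> : off_row b p * off_row b q * (y p * y q) =
    off_row b p * y q * (off_row b q * y p) by ring.
by rewrite ler_pM // mulr_ge0.
Qed.

(** If the ovals all failed, [ostrowski_disk] would give an index [k] with
    [d k] at most its radius [s k], and [s k * s j < d k * d j] for every other
    [j]. Multiplying the [k]-th inequality by [t >= 1] multiplies [d k] by [t], its
    radius by [t ^ g], and every other radius by at most [t ^ (1 - g)]. With
    [T = t ^ (1 - g)], all indices end up outside their disks as soon as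
    [s k < T * d k] and [s j * T < d j] for the other [j]. *)
Lemma ostrowski_oval g b d y : (1 < #|I|)%N -> 0 <= g < 1 ->
  (forall i j, 0 <= b i j) ->
  (forall i, 0 <= d i) -> (forall i, 0 <= y i) -> (exists i, 0 < y i) ->
  dominated b d y ->
  exists i j, i != j /\
    d i * d j <= ostrowski_radius g b i * ostrowski_radius g b j.
Proof.
move=> card2 g01 b0 d0 y0 ypos dom; apply: contrapT => far.
set s := ostrowski_radius g b in far *.
have {}far i j : i != j -> s i * s j < d i * d j.
  by move=> ij; rewrite ltNge; apply/negP => ?; apply: far; exists i, j.
have s0 i : 0 <= s i by exact: ostrowski_radius_ge0.
have [k dk_s] : exists k, d k <= s k by exact: ostrowski_disk ypos dom.
have dgt0 i j : i != j -> 0 < d i.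
  move=> ij; rewrite lt_neqAle d0 andbT; apply/eqP => di0.
  have := far _ _ ij; rewrite -di0 mul0r ltNge mulr_ge0 //.
have dk : 0 < d k.
  have [j jk] := exists_neq card2 k; apply: (dgt0 k j); by rewrite eq_sym.
have sk : 0 < s k by exact: lt_le_trans dk dk_s.
have dj j : j != k -> 0 < d j by exact: dgt0.
pose a := s k / d k.
have a1 : 1 <= a by rewrite ler_pdivlMr // mul1r.
have agt0 : 0 < a by rewrite divr_gt0.
pose m := \big[Num.max/0]_(j | j != k) (s j / d j).
have le_m j : j != k -> s j / d j <= m by move=> jk; apply: le_bigmax_cond.
have m0 : 0 <= m by exact: bigmax_ge_id.
have am1 : a * m < 1.
  rewrite -ltr_pdivlMl // mulr1; apply: bigmax_lt => [|j jk].
    by rewrite invr_gt0.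
  rewrite invf_div ltr_pdivrMr ?dj // mulrAC ltr_pdivlMr // mulrC.
  by apply: far; rewrite eq_sym.
(* The harmonic mean of [a] and [1 / m], in a form that makes sense for [m = 0]. *)
pose T := 2 * a / (1 + a * m).
have den0 : 0 < 1 + a * m by rewrite ltr_wpDr // mulr_ge0 // ltW.
have aT : a < T by rewrite ltr_pdivlMr // mulrC ltr_pM2r //; lra.
have Tm : T * m < 1 by rewrite mulrAC ltr_pdivrMr // mul1r -mulrA; lra.
have T1 : 1 <= T by apply: le_trans a1 (ltW aT).
case/andP: g01 => g0 g1.
have h0 : 0 < 1 - g by rewrite subr_gt0.
pose t := T `^ (1 - g)^-1.
have t1 : 1 <= t by rewrite -(powRr0 T) ler_powR // invr_ge0 ltW.
have t0 : 0 < t by exact: lt_le_trans t1.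
have tT : t `^ (1 - g) = T.
  by rewrite -powRrM mulVf ?gt_eqF // powRr1 // (le_trans ler01 T1).
pose w i := if i == k then t else 1.
have w0 i : 0 < w i by rewrite /w; case: ifP.
have wt i : w i <= t by rewrite /w; case: ifP.
have rowE i : off_row (fun i j => w i * b i j) i = w i * off_row b i.
  by rewrite /off_row mulr_sumr.
have b'0 i j : 0 <= w i * b i j by rewrite mulr_ge0 // ltW.
have [||i] := @ostrowski_disk g (fun i j => w i * b i j) (fun i => w i * d i) y
    _ b'0 y0 ypos.
- by rewrite g0.
- move=> i; rewrite -mulrA (le_trans (ler_wpM2l (ltW (w0 i)) (dom i))) //.
  by rewrite mulr_sumr ler_sum // => j _; rewrite mulrA.
apply/negP; rewrite -ltNge /ostrowski_radius rowE powRM ?off_row_ge0 // ?ltW //.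
have [->|ik] := eqVneq i k.
  have -> : off_col (fun i j => w i * b i j) k = off_col b k.
    by apply: eq_bigr => j /negbTE jk; rewrite /w jk mul1r.
  rewrite /w eqxx -mulrA -/(ostrowski_radius g b k) -/(s k).
  have tE : t = t `^ g * T.
    by rewrite -tT -powRD ?subrKC ?powRr1 // ?oner_eq0 // ltW.
  rewrite [ltRHS](_ : _ = t `^ g * (T * d k)); last by rewrite mulrA -tE.
  by rewrite ltr_pM2l ?powR_gt0 ?(lt_le_trans ltr01 T1) // -ltr_pdivrMr.
have -> : w i = 1 by rewrite /w (negbTE ik).
rewrite powR1 !mul1r.
have sT : s i * T < d i.
  rewrite -[ltRHS]mul1r -ltr_pdivrMr ?dj //; apply: le_lt_trans Tm.
  by rewrite mulrAC [leRHS]mulrC ler_wpM2r ?le_m // (le_trans ler01).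
apply: le_lt_trans sT; rewrite -tT /s /ostrowski_radius -mulrA.
rewrite ler_wpM2l ?powR_ge0 // -powRM ?off_col_ge0 // ?(ltW t0) //.
apply: ge0_ler_powR; rewrite ?nnegrE ?mulr_ge0 ?off_col_ge0 ?(ltW h0) ?(ltW t0) //.
(* Only the entry in row [k] of column [i] is scaled, and [1 <= t]. *)
rewrite /off_col mulr_suml; apply: ler_sum => j _.
by rewrite mulrC ler_wpM2l.
Qed.

End DominatedSystem.

Unset Implicit Arguments.

Theorem theorem3p8 (R : realType) (n : nat) (hn : (2 <= n)%N)
    (A : 'M[quat R]_n) (gamma : R) (hgamma : 0 <= gamma <= 1) :
  left_eigenvalues A `<=`
    \bigcup_(ij in [set ij : 'I_n * 'I_n | ij.1 != ij.2])
      cassini_oval A gamma ij.1 ij.2.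
Proof.
move=> l [x x0 Ax].
pose b i j := quat_mod (A i j).
pose d i := quat_mod (l - A i i).
pose y i := quat_mod (x i ord0).
have b0 i j : 0 <= b i j by exact: quat_mod_ge0.
have d0 i : 0 <= d i by exact: quat_mod_ge0.
have y0 i : 0 <= y i by exact: quat_mod_ge0.
have ypos : exists i, 0 < y i.
  have [i xi] : exists i, x i ord0 != 0.
    apply: contrapT => none; move/eqP: x0; apply; apply/matrixP => i j.
    rewrite (ord1 j) mxE; apply: contrapT => /eqP ?; apply: none; by exists i.
  by exists i; rewrite quat_mod_gt0.
have dom : dominated b d y.
  move=> i; rewrite -quat_modM.
  have -> : (l - A i i) * x i ord0 = \sum_(j | j != i) A i j * x j ord0.
    have /matrixP/(_ i ord0) := Ax; rewrite !mxE (bigD1 i) //= => eqi.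
    by rewrite mulrBl -eqi addrAC subrr add0r.
  apply: le_trans (quat_mod_sum _ _) _.
  by apply: ler_sum => j _; rewrite quat_modM.
have card2 : (1 < #|'I_n|)%N by rewrite card_ord.
have [i [j [ij oval]]] : exists i j, i != j /\
    d i * d j <= ostrowski_radius gamma b i * ostrowski_radius gamma b j.
  case/andP: hgamma => g0; rewrite le_eqVlt => /predU1P[->|g1].
    have [i [j [ij le]]] := brauer_oval card2 b0 d0 y0 ypos dom.
    exists i, j; split=> //; rewrite /ostrowski_radius subrr !powRr0 !mulr1.
    by rewrite !powRr1 ?off_row_ge0.
  by apply: ostrowski_oval ypos dom; rewrite ?g0.
exists (i, j) => //; apply: le_trans oval _.
by rewrite /ostrowski_radius mulrACA mulrA.
Qed.
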